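(* Let $n\ge1$ and $\vec a=(a_0,\dots,a_n)\in\mathbb{Z}^{n+1}$. If the vector $\vec a$ is not regular, then its tropical entropy satisfies $H(\vec a)\ge \frac14$.
   Context: A sequence $(z_1,\dots,z_k)\in\mathbb{R}^k$ satisfies $\vec a$ if for every $1\le j\le k-n$ the minimum $\min_{0\le i\le n}\{z_{j+i}+a_i\}$ is attained for at least two different values of $i$. $D(k)\subset\mathbb{R}^k$ denotes the set of all such sequences; it is a finite union of polyhedra. Put $d_{\vec a}(k):=\dim D(k)$ (the maximal dimension of a polyhedron in this union). The tropical entropy is $H(\vec a)=H_{\vec a}:=\lim_{k\to\infty}d_{\vec a}(k)/k$ (the limit exists by subadditivity of $d_{\vec a}$). The Newton polygon $\mathcal{N}(\vec a)\subset\mathbb{R}^2$ is the convex hull of the rays $\{(i,y): y\ge a_i\}$, $0\le i\le n$. The vector $\vec a$ is called regular if each point $(i,a_i)$ with $a_i<\infty$ is a vertex of $\mathcal{N}(\vec a)$ and the indices $i$ with $a_i<\infty$ form an arithmetic progression; since here all $a_i$ are finite integers, regular means that every point $(i,a_i)$, $0\le i\le n$, is a vertex of $\mathcal{N}(\vec a)$. *)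

(* Defs.v *)
From HB Require Import structures.
From mathcomp Require Import all_boot all_order all_algebra ring lra.
From mathcomp Require Import all_classical all_reals all_analysis.

Set Implicit Arguments.
Unset Strict Implicit.
Unset Printing Implicit Defensive.

Import Order.TTheory GRing.Theory Num.Theory.
Import numFieldNormedType.Exports.

Local Open Scope classical_set_scope.
Local Open Scope ring_scope.

Section Dimension.
Variables (R : realType) (k : nat).
Implicit Types P S : set 'rV[R]_k.

Definition polyhedron P : Prop :=
  exists (m : nat) (A : 'M[R]_(k, m)) (b : 'rV[R]_m),
    P = [set x | forall i, (x *m A) 0 i <= b 0 i].

(* Dimension of the affine hull: the largest m such that P contains m + 1
   affinely independent points p, p + V_0, ..., p + V_(m-1). It is 0 when P is
   empty. *)
Definition affdim P : nat :=
  \max_(m < k.+1 | `[< exists (p : 'rV[R]_k) (V : 'M[R]_(m, k)),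
      [/\ P p, forall i, P (p + row i V) & row_free V] >]) m.

(* Maximal dimension of a polyhedron contained in S. When S is a finite union
   of polyhedra, this is the maximal dimension of the members of the union,
   whichever way S is so decomposed: see [pdim_bigcup]. *)
Definition pdim S : nat :=
  \max_(m < k.+1 | `[< exists P,
      [/\ polyhedron P, P `<=` S & affdim P = m] >]) m.

Lemma affdim_max P m (p : 'rV[R]_k) (V : 'M[R]_(m, k)) :
  P p -> (forall i, P (p + row i V)) -> row_free V -> (m <= affdim P)%N.
Proof.
move=> Pp PV fV; have mk : (m < k.+1)%N by rewrite ltnS -(eqP fV) rank_leq_col.
rewrite (_ : m = Ordinal mk) //; apply: (leq_bigmax_cond (F := @nat_of_ord k.+1)).
by apply/asboolP; exists p, V.
Qed.

Lemma affdim_witness P : P !=set0 -> exists (p : 'rV[R]_k) (V : 'M[R]_(affdim P, k)),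
  [/\ P p, forall i, P (p + row i V) & row_free V].
Proof.
move=> [p Pp]; rewrite /affdim.
set C := (C in \max_(m < _ | C m) _).
have C0 : C ord0.
  apply/asboolP; exists p, 0; split=> //; first by case.
  by rewrite /row_free mxrank0.
rewrite (bigop.bigmax_eq_arg ord0 C0); case: arg_maxnP => // m /asboolP Cm _.
exact: Cm.
Qed.

Lemma affdim_le P : (affdim P <= k)%N.
Proof. by apply/bigmax_leqP => m _; rewrite -ltnS. Qed.

Lemma polyhedron_simplex P m (p : 'rV[R]_k) (V : 'M[R]_(m, k)) (c : 'rV[R]_m) :
  polyhedron P -> P p -> (forall i, P (p + row i V)) ->
  (forall i, 0 <= c 0 i) -> \sum_i c 0 i <= 1 -> P (p + c *m V).
Proof.
move=> [l [A [b ->]]] /= Pp PV c0 c1 j.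
pose d := b 0 j - (p *m A) 0 j.
have dP i : (V *m A) i j <= d.
  have := PV i j; rewrite mulmxDl mxE -row_mul [row _ _ _ _]mxE.
  by rewrite /d lerBrDl.
have d0 : 0 <= d by rewrite /d subr_ge0.
rewrite mulmxDl -mulmxA mxE -lerBrDl -/d mxE.
apply: (@le_trans _ _ (\sum_i c 0 i * d)).
  by apply: ler_sum => i _; rewrite ler_wpM2l.
by rewrite -mulr_suml ler_piMl.
Qed.

Lemma pdim_bigcup (I : finType) (P : I -> set 'rV[R]_k) :
  (forall i, polyhedron (P i)) ->
  pdim (\bigcup_i P i) = (\max_i affdim (P i))%N.
Proof.
move=> hP; apply/eqP; rewrite eqn_leq; apply/andP; split; last first.
  apply/bigmax_leqP => i _.
  have ltk : (affdim (P i) < k.+1)%N by rewrite ltnS affdim_le.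
  rewrite (_ : affdim (P i) = Ordinal ltk) //.
  apply: (leq_bigmax_cond (F := @nat_of_ord k.+1)); apply/asboolP.
  by exists (P i); split=> // x Px; exists i.
apply/bigmax_leqP => -[m' mk] /asboolP [Q [hQ QP /= <-]] {m' mk}.
have [->//|Qgt0] := posnP (affdim Q).
have [p [V [Qp QV fV]]] : exists p (V : 'M[R]_(affdim Q, k)),
    [/\ Q p, forall i, Q (p + row i V) & row_free V].
  apply: affdim_witness; apply: contrapT => /set0P /negP/negPn/eqP Q0.
  by move: Qgt0; rewrite Q0 /affdim big1 // => l /asboolP[p [V []]].
set m := affdim Q in Qgt0 p V Qp QV fV *.
(* N points of Q in general position, on a moment curve; one P i contains
   m + 1 of them. *)
pose N := (#|I| * m).+1.
pose e : R := (m%:R * N%:R ^+ m)^-1.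
have e0 : 0 < e by rewrite invr_gt0 mulr_gt0 ?exprn_gt0 ?ltr0n.
pose c (t : 'I_N) : 'rV[R]_m := \row_i (e * t%:R ^+ i.+1).
pose x t := p + c t *m V.
have Qx t : Q (x t).
  apply: polyhedron_simplex => //.
    by move=> i; rewrite mxE mulr_ge0 ?(ltW e0) ?exprn_ge0 ?ler0n.
  apply: (@le_trans _ _ (\sum_(i < m) e * N%:R ^+ m)).
    apply: ler_sum => i _; rewrite mxE ler_wpM2l ?(ltW e0) //.
    apply: (@le_trans _ _ (N%:R ^+ i.+1)).
      by rewrite lerXn2r ?nnegrE ?ler0n // ler_nat ltnW.
    by rewrite ler_weXn2l // ler1n.
  rewrite sumr_const card_ord -mulrnAr -[X in e * X]mulr_natl.
  by rewrite mulVf // mulf_neq0 ?expf_neq0 ?pnatr_eq0 -?lt0n.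
have /choice [f fP] t : exists i, P i (x t) by have [i _] := QP _ (Qx t); exists i.
have [i fi] : exists i, (m < #|[set t | f t == i]%SET|)%N.
  apply/existsP; apply: contraT; rewrite negb_exists => /forallP H.
  suff : (N <= #|I| * m)%N by rewrite ltnn.
  rewrite -[N]card_ord -sum1_card (partition_big f xpredT) //= -sum_nat_const.
  apply: leq_sum => i _; rewrite sum1_card.
  apply: leq_trans (_ : #|[set t | f t == i]%SET| <= m)%N; last by rewrite leqNgt H.
  by rewrite cardsE.
pose h (j : 'I_m.+1) : 'I_N := enum_val (widen_ord fi j).
have hi j : f (h j) = i by have := enum_valP (widen_ord fi j); rewrite inE => /eqP.
have h_inj : injective h by move=> j j' /enum_val_inj /(congr1 val) /= /val_inj.
apply: leq_trans (leq_bigmax i).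
pose C : 'M[R]_m := \matrix_j (c (h (lift ord0 j)) - c (h ord0)).
apply: (@affdim_max _ _ (x (h ord0)) (C *m V)).
- by rewrite -(hi ord0); exact: fP.
- move=> j; rewrite row_mul rowK mulmxBl /x addrACA subrr addr0 -/(x _).
  by rewrite -(hi (lift ord0 j)); exact: fP.
rewrite /row_free mxrankMfree // -mxrank_tr; apply: inj_row_free => u uC.
pose q0 : {poly R} := \sum_(l < m) u 0 l *: 'X^(l.+1).
have q0h j : q0.[(h j)%:R] = q0.[(h ord0)%:R].
  case: (unliftP ord0 j) => [j'|] -> //.
  apply/eqP; rewrite -subr_eq0 -(mulrI_eq0 _ (mulfI (lt0r_neq0 e0))).
  move/matrixP: uC => /(_ 0 j'); rewrite !mxE => <-; apply/eqP.
  rewrite /q0 !horner_sum -sumrB mulr_sumr; apply: eq_bigr => l _.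
  by rewrite !hornerZ !hornerXn !mxE; ring.
pose q := q0 - (q0.[(h ord0)%:R])%:P.
have q_eq0 : q = 0.
  apply: (@roots_geq_poly_eq0 _ q [seq (h j)%:R | j : 'I_m.+1]).
  - apply/allP => _ /mapP[j _ ->]; rewrite /root /q hornerD hornerN hornerC q0h.
    by rewrite subrr.
  - rewrite map_inj_uniq ?enum_uniq // => j j' /eqP; rewrite eqr_nat.
    by move=> /eqP /val_inj /h_inj.
  rewrite size_map -cardE card_ord.
  rewrite (leq_trans (size_polyD _ _)) // geq_max size_polyN.
  rewrite (leq_trans (size_polyC_leq1 _)) // andbT.
  apply: (leq_trans (size_sum _ _ _)); apply/bigmax_leqP => l _.
  rewrite (leq_trans (size_scale_leq _ _)) // size_polyXn ltnS; exact: ltn_ord.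
apply/rowP => l; rewrite mxE.
have /(congr1 (fun r : {poly R} => r`_l.+1)) := q_eq0.
rewrite /q coefB coefC /= subr0 coef0 coef_sum (bigD1 l) //= big1.
  by rewrite addr0 coefZ coefXn eqxx mulr1.
by move=> l' ll'; rewrite coefZ coefXn eqSS eq_sym (negPf (_ : l' != l :> nat)) ?mulr0.
Qed.

Lemma polyhedron_ineqs (J : finType) (u : J -> 'cV[R]_k) (b : J -> R) :
  polyhedron [set x : 'rV[R]_k | forall j, (x *m u j) 0 0 <= b j].
Proof.
exists #|J|, (\matrix_(i, j) u (enum_val j) i 0), (\row_j b (enum_val j)).
have E (x : 'rV[R]_k) j :
    (x *m \matrix_(i, j) u (enum_val j) i 0) 0 j = (x *m u (enum_val j)) 0 0.
  by rewrite !mxE; apply: eq_bigr => i _; rewrite mxE.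
apply/seteqP; split=> x /= H j; first by rewrite E [leRHS]mxE.
by have := H (enum_rank j); rewrite E [leRHS]mxE enum_rankK.
Qed.

End Dimension.

Section TropicalEntropy.
Variables (R : realType) (n : nat) (a : 'I_n.+1 -> int).

Lemma window_subproof k (j : 'I_(k - n)) (i : 'I_n.+1) : (j + i < k)%N.
Proof.
have nk : (n < k)%N by rewrite -subn_gt0 (leq_ltn_trans _ (ltn_ord j)).
by rewrite -[ltnRHS](subnK (ltnW nk)) -addSn leq_add // -ltnS.
Qed.

Definition window k (j : 'I_(k - n)) (i : 'I_n.+1) : 'I_k :=
  Ordinal (window_subproof j i).

Definition min_attained_twice (w : 'I_n.+1 -> R) : Prop :=
  exists i1 i2 : 'I_n.+1,
    [/\ i1 != i2, forall i, w i1 <= w i & forall i, w i2 <= w i].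

(* D(k); positions in z are counted from 0, and there is no condition when
   k <= n. *)
Definition trop_sols (k : nat) : set 'rV[R]_k :=
  [set z | forall j : 'I_(k - n),
     min_attained_twice (fun i => z 0 (window j i) + (a i)%:~R)].

Arguments trop_sols : clear implicits.

Lemma trop_sols_bigcup k : exists (I : finType) (P : I -> set 'rV[R]_k),
  (forall i, polyhedron (P i)) /\ trop_sols k = \bigcup_i P i.
Proof.
pose T := ('I_n.+1 * 'I_n.+1)%type.
pose I : finType := {f : {ffun 'I_(k - n) -> T} | [forall j, (f j).1 != (f j).2]}.
pose s (f : I) (j : 'I_(k - n)) (b : bool) :=
  if b then (val f j).1 else (val f j).2.
pose w (z : 'rV[R]_k) j i := z 0 (@window k j i) + (a i)%:~R.
exists I, (fun f => [set z | forall jib : 'I_(k - n) * 'I_n.+1 * bool,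
  w z jib.1.1 (s f jib.1.1 jib.2) <= w z jib.1.1 jib.1.2]); split.
  move=> f; rewrite /w.
  pose J : finType := ('I_(k - n) * 'I_n.+1 * bool)%type.
  pose u (x : J) : 'cV[R]_k :=
    delta_mx (window x.1.1 (s f x.1.1 x.2)) 0 - delta_mx (window x.1.1 x.1.2) 0.
  pose b (x : J) : R := (a x.1.2)%:~R - (a (s f x.1.1 x.2))%:~R.
  have -> : [set z : 'rV[R]_k | forall x : J,
      z 0 (window x.1.1 (s f x.1.1 x.2)) + (a (s f x.1.1 x.2))%:~R
        <= z 0 (window x.1.1 x.1.2) + (a x.1.2)%:~R] =
      [set z | forall x, (z *m u x) 0 0 <= b x].
    have E (z : 'rV[R]_k) l l' :
        (z *m (delta_mx l 0 - delta_mx l' (0 : 'I_1))) 0 0 = z 0 l - z 0 l'.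
      by rewrite mulmxBr -!colE !mxE.
    by apply/seteqP; split=> z /= + x => /(_ x); rewrite /b /u E; lra.
  exact: polyhedron_ineqs.
apply/seteqP; split => z /=.
  move=> Dz; have /choice [g gP] : forall j : 'I_(k - n), exists t : T,
      [/\ t.1 != t.2, forall i, w z j t.1 <= w z j i &
          forall i, w z j t.2 <= w z j i].
    by move=> j; have [i1 [i2 H]] := Dz j; exists (i1, i2).
  have fP : [forall j, ((finfun g) j).1 != ((finfun g) j).2].
    by apply/forallP => j; rewrite ffunE; have [] := gP j.
  exists (exist _ (finfun g) fP) => // -[[j i] b] /=.
  by rewrite /s /= ffunE; have [_ H1 H2] := gP j; case: b.
move=> [f _ fz] j; exists (val f j).1, (val f j).2; split.
- by have /forallP := valP f; apply.
- by move=> i; exact: (fz (j, i, true)).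
- by move=> i; exact: (fz (j, i, false)).
Qed.

(* limn is 0 on divergent sequences, so that a positive lower bound on the
   entropy entails that the limit exists. *)
Definition trop_entropy : R :=
  limn (fun k : nat => (pdim (trop_sols k))%:R / k%:R : R).

Definition newton_polygon : set (R^o * R^o) :=
  smallest (@convex_set R (R^o * R^o)%type)
    [set p | exists i : 'I_n.+1, p.1 = i%:R /\ (a i)%:~R <= p.2].

Definition is_vertex (N : set (R^o * R^o)) (p : R^o * R^o) : Prop :=
  N p /\ forall (q r : R^o * R^o) (t : R), N q -> N r -> 0 < t < 1 ->
    p = t *: q + (1 - t) *: r -> q = r.

(* All the a i are finite, so that the indices of the finite entries form the
   arithmetic progression 0, ..., n and no condition on them is needed. *)
Definition regular : Prop :=
  forall i : 'I_n.+1, is_vertex newton_polygon (i%:R, (a i)%:~R).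

End TropicalEntropy.

(* Main.v *)
(* The dimensions are subadditive, so that by Fekete's lemma the entropy is the
   infimum of d(k) / k, and it suffices to find enough free entries in long
   sequences. If (i, a_i) is not a vertex, subtracting an affine function from
   a gives A >= 0 with A_j = A_l = 0, L := l - j >= 2 and A > 0 before j and
   after l. Let b be the least A_i over the i not congruent to j modulo L.
   Residue classes modulo L get levels, the window at q being ruled by the class
   of q + j:
   - low classes are constantly 0, and the minimum is attained at j and l;
   - a mid class has level b, and some i with A_i = b leads from it to a low
     class. This i attains the minimum, so one of the entries q + j, q + l may
     be raised freely: half of the entries of the class are free;
   - a top class has level c in [b, 2 b], and each i with A_i = b leads from it
     to a mid class. At every other window the minimum c is attained outside the
     class. At the windows between, either it still is, or both entries of the
     class can be raised by the same small amount: a quarter is free.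
   If the set of low classes is maximal among those with at least as many mid as
   low classes, the remaining classes are indeed top, and the density of the
   free entries is at least 1 / 4. *)

Require Import Defs.
From mathcomp Require Import all_boot all_order all_algebra ring lra zify.
From mathcomp Require Import all_classical all_reals all_analysis.

Set Implicit Arguments.
Unset Strict Implicit.
Unset Printing Implicit Defensive.

Import Order.TTheory GRing.Theory Num.Theory.
Import numFieldNormedType.Exports.

Local Open Scope classical_set_scope.
Local Open Scope ring_scope.

(** * Dimensions of polyhedra and their products *)

Section Dimension.
Variable R : realType.

Lemma mxrank_le_affdim k (P : set 'rV[R]_k) m (p : 'rV[R]_k) (V : 'M[R]_(m, k)) :
  P p -> (forall i, P (p + row i V)) -> (\rank V <= affdim P)%N.
Proof.
move=> Pp PV; apply: (@affdim_max _ _ _ _ p (rowsub (maxrankfun V) V)) => //.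
  by move=> i; rewrite row_rowsub.
exact: maxrowsub_free.
Qed.

Lemma pdim_ge_affdim k (S P : set 'rV[R]_k) :
  polyhedron P -> P `<=` S -> (affdim P <= pdim S)%N.
Proof.
move=> polP PS; have ltk : (affdim P < k.+1)%N by rewrite ltnS affdim_le.
rewrite (_ : affdim P = Ordinal ltk) //.
by apply: (leq_bigmax_cond (F := @nat_of_ord k.+1)); apply/asboolP; exists P.
Qed.

Lemma pdim_subset k (S T : set 'rV[R]_k) : S `<=` T -> (pdim S <= pdim T)%N.
Proof.
move=> ST; apply/bigmax_leqP => m /asboolP[P [polP PS <-]].
exact: pdim_ge_affdim (subset_trans PS ST).
Qed.

Definition rV_prod k l (P : set 'rV[R]_k) (Q : set 'rV[R]_l) : set 'rV[R]_(k + l) :=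
  [set x | P (lsubmx x) /\ Q (rsubmx x)].

Lemma polyhedron_prod k l (P : set 'rV[R]_k) (Q : set 'rV[R]_l) :
  polyhedron P -> polyhedron Q -> polyhedron (rV_prod P Q).
Proof.
move=> [m [A [b ->]]] [m' [A' [b' ->]]].
exists (m + m')%N, (row_mx (col_mx A 0) (col_mx 0 A')), (row_mx b b').
have E (x : 'rV[R]_(k + l)) : x *m row_mx (col_mx A 0) (col_mx 0 A') =
    row_mx (lsubmx x *m A) (rsubmx x *m A').
  by rewrite -{1}(hsubmxK x) mul_mx_row !mul_row_col !mulmx0 addr0 add0r.
apply/seteqP; split=> x /=; rewrite E.
  by move=> [H H'] i; case: (split_ordP i) => {}i ->; rewrite ?row_mxEl ?row_mxEr.
by move=> H; split=> i; [have := H (lshift m' i)|have := H (rshift m i)];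
  rewrite ?row_mxEl ?row_mxEr.
Qed.

(** Directions in the product split into two blocks, one for each factor, and the rank is at most
    the sum of the ranks of the blocks. *)
Lemma affdim_prod k l (P : set 'rV[R]_k) (Q : set 'rV[R]_l) :
  (affdim (rV_prod P Q) <= affdim P + affdim Q)%N.
Proof.
have [->|PQ0] := eqVneq (rV_prod P Q) set0.
  by rewrite /affdim big1 // => m /asboolP[p [V []]].
have [p [V [[Pp Qp] PQV freeV]]] := affdim_witness (iffLR (set0P _) PQ0).
rewrite -(eqP freeV) -(hsubmxK V) -mxrank_tr tr_row_mx -addsmxE.
apply: leq_trans (mxrank_adds_leqif _ _) _; rewrite !mxrank_tr.
apply: leq_add.
  apply: (mxrank_le_affdim Pp) => i; have [+ _] := PQV i.
  by congr P; apply/rowP => j; rewrite !mxE.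
apply: (mxrank_le_affdim Qp) => i; have [_] := PQV i.
by congr Q; apply/rowP => j; rewrite !mxE.
Qed.

End Dimension.

(** * Subadditivity and lower bounds for the dimension of the solution sets *)

Section TropicalSequences.
Variables (R : realType) (n : nat) (a : 'I_n.+1 -> int).

Definition tdim k : nat := pdim (@trop_sols R n a k).

(** The windows across the cut are dropped; all others lie in one of the two pieces. *)
Lemma trop_sols_prod k l :
  @trop_sols R n a (k + l) `<=` rV_prod (@trop_sols R n a k) (@trop_sols R n a l).
Proof.
move=> x Dx; split=> j.
  have jkl : (j < k + l - n)%N by have := ltn_ord j; lia.
  have := Dx (Ordinal jkl); congr min_attained_twice; apply/funext => i.
  by rewrite mxE; congr (x 0 _ + _); exact: val_inj.
have jkl : (k + j < k + l - n)%N by have := ltn_ord j; lia.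
have := Dx (Ordinal jkl); congr min_attained_twice; apply/funext => i.
by rewrite mxE; congr (x 0 _ + _); apply: val_inj => /=; rewrite addnA.
Qed.

Lemma tdimD k l : (tdim (k + l) <= tdim k + tdim l)%N.
Proof.
have [I [P [polP EP]]] := trop_sols_bigcup R a k.
have [J [Q [polQ EQ]]] := trop_sols_bigcup R a l.
pose PQ (x : I * J) := rV_prod (P x.1) (Q x.2).
have polPQ x : polyhedron (PQ x) by exact: polyhedron_prod.
apply: leq_trans (_ : pdim (\bigcup_x PQ x) <= _)%N.
  apply: pdim_subset; apply: subset_trans (@trop_sols_prod k l) _.
  by rewrite EP EQ => x [[i _ Pi] [j _ Qj]]; exists (i, j).
rewrite pdim_bigcup //; apply/bigmax_leqP => -[i j] _ /=.
apply: leq_trans (affdim_prod _ _) _; apply: leq_add.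
  by apply: pdim_ge_affdim => //; rewrite EP => x Px; exists i.
by apply: pdim_ge_affdim => //; rewrite EQ => x Px; exists j.
Qed.

Lemma tdimM m k : (tdim (m * k) <= m * tdim k)%N.
Proof.
elim: m => [|m IHm]; first by rewrite mul0n; apply/bigmax_leqP => -[].
by rewrite mulSn; apply: leq_trans (tdimD _ _) _; rewrite leq_add2l.
Qed.

(* Each window comes with a fixed pair of positions at which its minimum is
   attained; once these are fixed, the conditions define a polyhedron. *)
Lemma tdim_ge k m (p : 'rV[R]_k) (V : 'M[R]_(m, k))
    (s : 'I_(k - n) -> bool -> 'I_n.+1) :
  (forall j, s j true != s j false) -> row_free V ->
  (forall x, x = p \/ (exists i, x = p + row i V) -> forall j c i,
     x 0 (window j (s j c)) + (a (s j c))%:~R <= x 0 (window j i) + (a i)%:~R) ->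
  (m <= tdim k)%N.
Proof.
move=> s_neq freeV min_s; rewrite -(eqP freeV).
pose J : finType := ('I_(k - n) * bool * 'I_n.+1)%type.
pose u (x : J) : 'cV[R]_k :=
  delta_mx (window x.1.1 (s x.1.1 x.1.2)) 0 - delta_mx (window x.1.1 x.2) 0.
pose d (x : J) : R := (a x.2)%:~R - (a (s x.1.1 x.1.2))%:~R.
pose P := [set x : 'rV[R]_k | forall y, (x *m u y) 0 0 <= d y].
have E (x : 'rV[R]_k) y : (x *m u y) 0 0 =
    x 0 (window y.1.1 (s y.1.1 y.1.2)) - x 0 (window y.1.1 y.2).
  by rewrite mulmxBr -!colE !mxE.
have P_min (x : 'rV[R]_k) : (forall j c i, x 0 (window j (s j c)) + (a (s j c))%:~R
    <= x 0 (window j i) + (a i)%:~R) -> P x.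
  by move=> H [[j c] i]; rewrite E /d /=; have := H j c i; lra.
apply: (@leq_trans (affdim P)).
  by apply: (@mxrank_le_affdim _ _ _ _ p) => [|i]; apply: P_min; apply: min_s;
    [left|right; exists i].
apply: pdim_ge_affdim; first exact: polyhedron_ineqs.
move=> x Px j; exists (s j true), (s j false); split=> // i.
  by have := Px (j, true, i); rewrite E /d /=; lra.
by have := Px (j, false, i); rewrite E /d /=; lra.
Qed.

End TropicalSequences.

(** * Fekete's subadditive lemma *)

Lemma fekete (R : realType) (u : nat -> nat) :
  (forall k l, (u (k + l) <= u k + u l)%N) ->
  (fun k => (u k)%:R / k%:R : R) @ \oo -->
    inf [set ((u k)%:R / k%:R : R) | k in [set k | (0 < k)%N]].
Proof.
move=> uD; set S := [set _ | _ in _]; set l := inf S.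
have S0 : S !=set0 by exists ((u 1)%:R / 1%:R); exists 1.
have lbS : has_lbound S by exists 0 => _ [k _ <-]; rewrite divr_ge0.
have uM m k r : (u (m * k + r) <= m * u k + u r)%N.
  elim: m => [//|m IHm]; rewrite !mulSn -!addnA.
  by apply: leq_trans (uD _ _) _; rewrite leq_add2l.
have u_le k : (u k <= k * u 1 + u 0)%N by have := uM k 1 0; rewrite muln1 addn0.
apply/cvgrPdist_le => e e0.
have [_ [N /= N0 <-] ltN] := inf_adherent (divr_gt0 e0 (ltr0Sn _ 1)) (conj S0 lbS).
(* [C] bounds [u r] for every remainder [r < N]. *)
pose C := (N * u 1 + u 0)%N.
near=> k.
have k0 : (0 < k)%N by near: k; exact: nbhs_infty_gt.
have l_le : l <= (u k)%:R / k%:R by apply: ge_inf => //; exists k.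
rewrite distrC ger0_norm ?subr_ge0 // lerBlDl.
have Ck : C%:R / k%:R <= e / 2.
  rewrite ler_pdivrMr ?ltr0n // mulrC -ler_pdivrMr ?divr_gt0 //.
  by near: k; exact: nbhs_infty_ger.
have uk : (u k)%:R <= (u N)%:R / N%:R * k%:R + C%:R :> R.
  have : (u k <= k %/ N * u N + C)%N.
    rewrite {1}(divn_eq k N); apply: leq_trans (uM _ _ _) _.
    rewrite leq_add2l (leq_trans (u_le _)) // leq_add2r leq_mul2r.
    by rewrite (ltnW (ltn_pmod k N0)) orbT.
  rewrite -(ler_nat R) natrD natrM => /le_trans; apply; rewrite lerD2r.
  rewrite mulrAC -mulrA mulrC ler_wpM2l // ler_pdivlMr ?ltr0n //.
  by rewrite -natrM ler_nat leq_trunc_div.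
apply: (@le_trans _ _ ((u N)%:R / N%:R + C%:R / k%:R)).
  by rewrite ler_pdivrMr ?ltr0n // mulrDl mulfVK // pnatr_eq0 -lt0n.
by move: ltN Ck; rewrite -/S -/l; lra.
Unshelve. all: by end_near. Qed.

(** * Vertices and edges of the Newton polygon *)

Section NewtonPolygon.
Variables (R : realType) (n : nat) (a : 'I_n.+1 -> int).
Local Notation pt i := ((nat_of_ord i)%:R : R).
Local Notation ht i := ((a i)%:~R : R).

(** The half-plane above a supporting line is convex and contains the generating points. *)
Lemma newton_polygon_above (i : 'I_n.+1) (s : R) p :
  (forall m, ht i + s * (pt m - pt i) <= ht m) ->
  newton_polygon a p -> ht i + s * (p.1 - pt i) <= p.2.
Proof.
move=> le_s; pose C := [set p : R^o * R^o | ht i + s * (p.1 - pt i) <= p.2].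
apply: (@smallest_sub _ _ _ C).
  move=> x y t; rewrite !inE /C /= => xC yC.
  have t0 : 0 <= t%:num by [].
  have t1 : 0 <= 1 - t%:num by rewrite subr_ge0.
  have := lerD (ler_wpM2l t0 xC) (ler_wpM2l t1 yC).
  apply: le_trans; rewrite le_eqVlt; apply/orP; left; apply/eqP.
  rewrite /unstable.onem /GRing.scale /=; ring.
by move=> q [m [q1 q2]]; apply: le_trans q2; rewrite q1; exact: le_s.
Qed.

(** A segment through the point has its ends above both supporting lines, hence on both, so each end
    is the point itself. *)
Lemma is_vertex_slopes (i : 'I_n.+1) (s1 s2 : R) : s1 < s2 ->
  (forall m, ht i + s1 * (pt m - pt i) <= ht m) ->
  (forall m, ht i + s2 * (pt m - pt i) <= ht m) ->
  is_vertex (newton_polygon a) (pt i, ht i).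
Proof.
move=> s12 le1 le2; split; first by apply: sub_gen_smallest; exists i.
move=> [q1 q2] [r1 r2] t Nq Nr /andP[t0 t1] [E1 E2].
have := newton_polygon_above le1 Nq; have := newton_polygon_above le2 Nq.
have := newton_polygon_above le1 Nr; have := newton_polygon_above le2 Nr.
rewrite /=; rewrite /GRing.scale /= in E1 E2.
set x := pt i in E1 E2 *; set y := ht i in E1 E2 *.
move=> r_2 r_1 q_2 q_1.
pose u s := t * (q2 - (y + s * (q1 - x))).
pose v s := (1 - t) * (r2 - (y + s * (r1 - x))).
have uv s : u s + v s = 0 by rewrite /u /v E1 E2; ring.
have t1' : 0 < 1 - t by rewrite subr_gt0.
have u0 s : 0 <= u s -> 0 <= v s -> u s = 0 /\ v s = 0.
  by have := uv s; lra.
have E (s : R) : y + s * (q1 - x) <= q2 -> y + s * (r1 - x) <= r2 ->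
    q2 = y + s * (q1 - x) /\ r2 = y + s * (r1 - x).
  move=> qs rs; have [||/eqP us /eqP vs] := u0 s.
  - by rewrite mulr_ge0 ?subr_ge0 // ltW.
  - by rewrite mulr_ge0 ?subr_ge0 // ltW.
  move: us vs; rewrite /u /v !mulf_eq0 (gt_eqF t0) (gt_eqF t1') /= !subr_eq0.
  by move=> /eqP -> /eqP ->.
have [uq ur] := E _ q_1 r_1; have [vq vr] := E _ q_2 r_2.
have : (s2 - s1) * (q1 - x) = 0 by lra.
have : (s2 - s1) * (r1 - x) = 0 by lra.
have d0 : (s2 - s1 == 0) = false by apply: gt_eqF; rewrite subr_gt0.
move=> /eqP; rewrite mulf_eq0 d0 subr_eq0 /= => /eqP rx.
move=> /eqP; rewrite mulf_eq0 d0 subr_eq0 /= => /eqP qx.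
by rewrite uq ur rx qx.
Qed.

Definition height_above (s : R) (j i : 'I_n.+1) : R :=
  ht i - ht j - (pt i - pt j) * s.

(* If i is not a vertex, some chord over j < i < l passes through or below it.
   The chord lowest at i spans a supporting line, of which we take the extreme
   points of contact. *)
Lemma nonregular_wide_edge : ~ regular R a -> exists (s : R) (j l : 'I_n.+1),
  [/\ (j.+1 < l)%N, height_above s j l = 0, forall i, 0 <= height_above s j i &
      forall i : 'I_n.+1, (i < j)%N || (l < i)%N -> 0 < height_above s j i].
Proof.
move=> /existsNP[i not_vtx].
pose sl (m m' : 'I_n.+1) := (ht m' - ht m) / (pt m' - pt m).
pose ch (x : 'I_n.+1 * 'I_n.+1) := ht x.1 + sl x.1 x.2 * (pt i - pt x.1).
pose Pch (x : 'I_n.+1 * 'I_n.+1) := (x.1 < i < x.2)%N.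
have ptlt (m m' : 'I_n.+1) : (m < m')%N -> 0 < pt m' - pt m by rewrite subr_gt0 ltr_nat.
have [x0 Px0 ch0] : exists2 x, Pch x & ch x <= ht i.
  apply: contrapT => noch; apply: not_vtx.
  have lt_sl (m m' : 'I_n.+1) : (m < i)%N -> (i < m')%N -> sl m i < sl i m'.
    move=> mi im'; rewrite ltNge; apply/negP => le_sl; apply: noch.
    exists (m, m'); first by rewrite /Pch /= mi.
    rewrite /ch /=.
    have d1 := ptlt _ _ mi; have d2 := ptlt _ _ im'.
    have d3 := ptlt _ _ (ltn_trans mi im').
    move: le_sl; rewrite /sl ler_pdivrMr // mulrAC ler_pdivlMr // => le_sl.
    rewrite -lerBrDl mulrAC ler_pdivrMr //; nra.
  (* The seeds cover an [i] with no index on one side: [s0] lies below all slopes to the right, and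
     [s1 + 1] above [s1]. *)
  pose s0 := \big[Num.min/0]_(m' : 'I_n.+1 | (i < m')%N) sl i m' - 1.
  pose s1 := \big[Num.max/s0]_(m : 'I_n.+1 | (m < i)%N) sl m i.
  pose s2 := \big[Num.min/s1 + 1]_(m' : 'I_n.+1 | (i < m')%N) sl i m'.
  have s12 : s1 < s2.
    rewrite /s2; apply: lt_bigmin => [|m' im']; first by rewrite ltrDl.
    apply: bigmax_lt => [|m mi]; last exact: lt_sl.
    by rewrite ltrBlDr (le_lt_trans (bigmin_le_cond _ (sl i) im')) ?ltrDl.
  have ge_s1 (m : 'I_n.+1) : (m < i)%N -> sl m i <= s1.
    by move=> mi; exact: (le_bigmax_cond _ (fun m => sl m i)).
  have le_s2 (m : 'I_n.+1) : (i < m)%N -> s2 <= sl i m.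
    by move=> mi; exact: (bigmin_le_cond _ (sl i)).
  have H s : s1 <= s -> s <= s2 -> forall m, ht i + s * (pt m - pt i) <= ht m.
    move=> h1 h2 m; case: (ltngtP m i) => [mi|im|/val_inj ->];
      last by rewrite subrr mulr0 addr0.
      have := le_trans (ge_s1 _ mi) h1; rewrite /sl ler_pdivrMr ?ptlt //; lra.
    have := le_trans h2 (le_s2 _ im); rewrite /sl ler_pdivlMr ?ptlt //; lra.
  by apply: (is_vertex_slopes s12); apply: H; rewrite ?lexx ?(ltW s12).
case: (arg_minP ch Px0) => -[m m'] /andP[/= mi im'] min_ch.
have {}ch0 : ch (m, m') <= ht i by exact: le_trans (min_ch _ Px0) ch0.
have mm' := ltn_trans mi im'.
pose s := sl m m'.
pose B u := ht u - ht m - (pt u - pt m) * s.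
have Bm : B m = 0 by rewrite /B; lra.
have Bm' : B m' = 0.
  by rewrite /B /s /sl mulrC divfK ?gt_eqF ?ptlt // subrr.
(* At [i], the chord over [u], [v] differs from the lowest one by the interpolation of [B u] and
   [B v], which is thus nonnegative. Pairing [u] with [m] or [m'], where [B] vanishes, gives
   [0 <= B u] away from [i]. *)
have chB (u v : 'I_n.+1) : (u < v)%N ->
    ch (u, v) = ht m + (pt i - pt m) * s
      + (B u * (pt v - pt i) + B v * (pt i - pt u)) / (pt v - pt u).
  move=> uv; rewrite /ch /B /sl /=; field.
  by rewrite gt_eqF ?ptlt.
have min_B (u v : 'I_n.+1) : (u < i)%N -> (i < v)%N ->
    0 <= B u * (pt v - pt i) + B v * (pt i - pt u).
  move=> ui iv; have uv := ltn_trans ui iv.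
  have := min_ch (u, v); rewrite /Pch /= ui iv => /(_ isT).
  rewrite !chB // Bm Bm' !mul0r addr0 mul0r addr0 lerDl.
  by rewrite pmulr_lge0 // invr_gt0 ptlt.
have B0 u : 0 <= B u.
  case: (ltngtP u i) => [ui|iu|/val_inj ->].
  - by have := min_B _ _ ui im'; rewrite Bm' mul0r addr0 pmulr_lge0 // ptlt.
  - by have := min_B _ _ mi iu; rewrite Bm mul0r add0r pmulr_lge0 // ptlt.
  - by move: ch0; rewrite chB // Bm Bm' !mul0r addr0 mul0r /B; lra.
have [j /eqP Bj min_j] : {j | B j == 0 & forall u : 'I_n.+1, B u == 0 -> (j <= u)%N}.
  by exists [arg min_(u < m | B u == 0) u]; case: arg_minnP; rewrite ?Bm.
have [l /eqP Bl max_l] : {l | B l == 0 & forall u : 'I_n.+1, B u == 0 -> (u <= l)%N}.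
  by exists [arg max_(u > m | B u == 0) u]; case: arg_maxnP; rewrite ?Bm.
exists s, j, l.
have AB u : height_above s j u = B u by rewrite /height_above; move: Bj; rewrite /B; lra.
split=> [||u|u ujl]; rewrite ?AB //.
  apply: (@leq_ltn_trans i); first by rewrite (leq_ltn_trans _ mi) ?min_j ?Bm.
  by rewrite (leq_trans im') ?max_l ?Bm'.
rewrite lt_neqAle B0 andbT; apply/eqP => /esym/eqP Bu.
by have := min_j u Bu; have := max_l u Bu; lia.
Qed.

End NewtonPolygon.

(** * Low, mid and top vertices of a finite digraph *)

Section Coloring.
Variables (T : finType) (e : rel T).

Definition mid_of (W : {set T}) : {set T} :=
  [set r | (r \notin W) && [exists s in W, e r s]]%SET.

(* Take W maximal: if r and s were both outside W and mid_of W with e r s, then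
   s could be added to W, as r would be added to mid_of W. *)
Lemma low_mid_top : irreflexive e -> exists2 W : {set T}, (#|W| <= #|mid_of W|)%N &
  forall r s, r \notin W -> r \notin mid_of W -> e r s -> s \in mid_of W.
Proof.
move=> irr_e; pose P (W : {set T}) := (#|W| <= #|mid_of W|)%N.
have [W /maxsetP[PW maxW]] : {W | maxset P W}.
  by apply: ex_maxset; exists finset.set0; rewrite /P cards0.
exists W => // r s rW rM ers; apply: contraT => sM.
have sW : s \notin W.
  by apply: contra rM => sW; rewrite inE rW; apply/existsP; exists s; rewrite sW.
have rs : r != s by apply: contraTneq ers => ->; rewrite irr_e.
have subM : (r |: mid_of W \subset mid_of (s |: W))%SET.
  apply/fintype.subsetP => x /setU1P[->|xM].
    by rewrite !inE negb_or rs rW; apply/existsP; exists s; rewrite !inE eqxx ers.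
  have xs : x != s by apply: contraNneq sM => <-.
  move: xM; rewrite !inE negb_or xs => /andP[-> /existsP[y /andP[yW exy]]].
  by apply/existsP; exists y; rewrite !inE yW orbT.
have : P (s |: W)%SET.
  rewrite /P cardsU1 sW (leq_trans _ (subset_leq_card subM)) // cardsU1 rM.
  by rewrite leq_add2l.
move=> /maxW/(_ (finset.subsetUr _ _)) eqW.
by move: sW; rewrite -eqW !inE eqxx.
Qed.

End Coloring.

(** * Sequences with free entries over a wide edge *)

Lemma gap_exists (R : realType) (I : finType) (F : I -> R) :
  exists2 e : R, 0 < e & forall i, 0 < F i -> e <= F i.
Proof.
exists (\big[Num.min/1]_(i | 0 < F i) F i); first exact: lt_bigmin.
by move=> i Fi; exact: (bigmin_le_cond _ F).
Qed.

(* p + d y changes p on the set of rp only at y, and for each window q the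
   minimum is attained at s q true and s q false along all these sequences. *)
Definition solution_family (R : realType) (n L : nat) (A : 'I_n.+1 -> R) : Prop :=
  exists (e : R) (p : nat -> R) (d : nat -> nat -> R)
    (s : nat -> bool -> 'I_n.+1) (rp : nat -> bool),
  [/\ e != 0, forall q, s q true != s q false,
      forall q k (i : 'I_n.+1), p (q + s q k)%N + A (s q k) <= p (q + i)%N + A i,
      forall y q k (i : 'I_n.+1), p (q + s q k)%N + d y (q + s q k)%N + A (s q k)
        <= p (q + i)%N + d y (q + i)%N + A i &
      (forall x y, rp x -> d y x = if x == y then e else 0) /\
      forall q, (q * L <= \sum_(0 <= x < q * 4 * L) rp x)%N].

Section Construction.
Variables (R : realType) (n L : nat) (A : 'I_n.+1 -> R) (j l : 'I_n.+1).
Hypotheses (L_gt1 : (1 < L)%N) (lE : l = (L + j)%N :> nat) (Aj : A j = 0) (Al : A l = 0).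
Hypotheses (A_ge0 : forall i, 0 <= A i).
Hypothesis A_gt0 : forall i : 'I_n.+1, (i < j)%N || (l < i)%N -> 0 < A i.

Let L_gt0 : (0 < L)%N. Proof. exact: ltnW. Qed.

Definition cls (x : nat) : 'Z_L := x%:R.
Definition off (i : 'I_n.+1) : 'Z_L := cls i - cls j.

Lemma clsDL x m : cls (x + m * L) = cls x.
Proof. by rewrite /cls natrD natrM pchar_Zp // mulr0 addr0. Qed.

Lemma cls_off q (i : 'I_n.+1) : cls (q + i) = cls (q + j) + off i.
Proof. by rewrite /off /cls !natrD; ring. Qed.

Lemma cls_l q : cls (q + l) = cls (q + j).
Proof. by rewrite lE addnCA addnC -[X in (_ + X)%N]mul1n clsDL. Qed.

Lemma off_l : off l = 0.
Proof. by rewrite /off -[X in cls X]add0n cls_l subrr. Qed.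

(** Between [j] and [l = j + L], only the two ends are congruent to [j] modulo [L]. *)
Lemma off_eq0 (i : 'I_n.+1) : off i = 0 -> [\/ i = j, i = l | 0 < A i].
Proof.
move=> /subr0_eq /(congr1 (@nat_of_ord _)); rewrite !val_Zp_nat // => ij.
case: (ltnP i j) => [ij'|ji]; first by apply: Or33; apply: A_gt0; rewrite ij'.
case: (ltnP l i) => [li|il]; first by apply: Or33; apply: A_gt0; rewrite li orbT.
have dvd : (L %| i - j)%N by rewrite -eqn_mod_dvd //; apply/eqP.
have [E|k0] := posnP (i - j)%N.
  by apply: Or31; apply: val_inj => /=; lia.
apply: Or32; apply: val_inj => /=.
by have := dvdn_leq k0 dvd; lia.
Qed.

Section Levels.
Variable i0 : 'I_n.+1.
Let b := A i0.
Hypotheses (off_i0 : off i0 != 0) (b_min : forall i, off i != 0 -> b <= A i).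

Definition cheap : rel 'Z_L :=
  fun r s => [exists i, [&& off i != 0, A i == b & s == r + off i]].

Variable W : {set 'Z_L}.
Let M := mid_of cheap W.
Hypothesis W_le_M : (#|W| <= #|M|)%N.
Hypothesis top_cheap :
  forall r s, r \notin W -> r \notin M -> cheap r s -> s \in M.

(** The hypotheses make [c r] the least of [2 b] and of the [A i] leading from [r] to another class
    in [W]; [2 b] is the price of passing through a mid class. *)
Variable c : 'Z_L -> R.
Hypotheses (b_le_c : forall r, b <= c r) (c_le2b : forall r, c r <= b + b).
Hypothesis c_low : forall r i, off i != 0 -> r + off i \in W -> c r <= A i.
Hypothesis c_att : forall r, c r = b + b \/
  exists i, [/\ off i != 0, r + off i \in W & A i = c r].

Definition lev (r : 'Z_L) : R :=
  if r \in W then 0 else if r \in M then b else c r.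

Variable eps : R.
Hypotheses (eps_gt0 : 0 < eps).
Hypothesis eps_gap : forall r r' i,
  0 < lev r' + A i - lev r -> eps <= lev r' + A i - lev r.

Let low x := cls x \in W.
Let mid x := cls x \in M.
Let top x := ~~ low x && ~~ mid x.

Let lev_cls x : lev (cls x) = if low x then 0 else if mid x then b else c (cls x).
Proof. by []. Qed.

Let mid_low x : mid x -> low x = false.
Proof. by rewrite /mid /low inE => /andP[/negbTE]. Qed.

(* The truncated quotients by L, shifted so that tau (q + j) = mu (q + i0). *)
Let mu x := (x %/ L + j)%N.
Let tau x := ((x + i0 + L.-1 * j) %/ L)%N.

Let muDL x m : mu (x + m * L) = (mu x + m)%N.
Proof. by rewrite /mu [(x + m * L)%N]addnC divnMDl //; lia. Qed.

Let tauDL x m : tau (x + m * L) = (tau x + m)%N.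
Proof.
rewrite /tau (_ : _ + _ + _ + _ = m * L + (x + i0 + L.-1 * j))%N; last by lia.
by rewrite divnMDl // addnC.
Qed.

Let qlE q : (q + l = q + j + 1 * L)%N. Proof. by rewrite lE; lia. Qed.

Let tau_mu q : tau (q + j) = mu (q + i0).
Proof.
have -> : tau (q + j) = ((j * L + (q + i0)) %/ L)%N.
  congr (_ %/ _)%N; case: (L) L_gt0 => [//|k] _; rewrite mulnS /=; lia.
by rewrite divnMDl // addnC.
Qed.

(* If q + j is in a top class, such an i attains the minimum of the window at q
   for all free values w. *)
Definition support q (i : 'I_n.+1) : bool :=
  [&& off i != 0, low (q + i) || mid (q + i) && ~~ odd (mu (q + i))
    & lev (cls (q + i)) + A i == c (cls (q + j))].

(** If [lone x] fails, the window at [x - j] has no support, so its entries [x] and [x + L] are to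
    be raised together; [j <= x] says that this window exists. *)
Definition lone x : bool :=
  ~~ [&& (j <= x)%N, (tau x %% 4 == 1)%N & ~~ [exists i, support (x - j) i]].

(* The positions whose values are free; in a top class, x + L repeats the value
   at x unless lone x. *)
Definition rep x : bool :=
  (mid x && odd (mu x)) || (top x && (tau x %% 4 == 1)%N).

(** The extra [eps] keeps raised mid entries from undercutting a top window whose minimum is raised
    by at most [eps]. *)
Definition raise (w : nat -> R) x : R :=
  if low x then 0 else
  if mid x then (if odd (mu x) then eps + w x else 0) else
  if (tau x %% 4 == 1)%N then w x else
  if [&& (tau x %% 4 == 2)%N, (L <= x)%N & ~~ lone (x - L)] then w (x - L)%N else 0.

Definition zseq w x : R := lev (cls x) + raise w x.

Let b_ge0 : 0 <= b. Proof. exact: A_ge0. Qed.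

Lemma lev_ge0 r : 0 <= lev r.
Proof.
rewrite /lev; case: ifP => // _; case: ifP => // _.
exact: le_trans b_ge0 (b_le_c r).
Qed.

Lemma raise_ge0 w x : (forall y, 0 <= w y) -> 0 <= raise w x.
Proof.
move=> w0; rewrite /raise; do 2?case: ifP => _ //; do 2?case: ifP => // _.
by rewrite addr_ge0 // ltW.
Qed.

(** An index leading to another class that is not low costs at least [b] in level and [b] in [A], so
    at least the cap of [c]. *)
Lemma top_le q (i : 'I_n.+1) : top (q + j) ->
  c (cls (q + j)) <= lev (cls (q + i)) + A i.
Proof.
move=> /andP[nlow nmid]; have [eq0|neq0] := eqVneq (off i) 0.
  rewrite (cls_off q i) eq0 addr0 lev_cls (negPf nlow) (negPf nmid).
  by rewrite lerDl.
rewrite [lev _]lev_cls; case: ifP => [iW|_]; first by rewrite add0r c_low // -cls_off.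
apply: (le_trans (c_le2b _)); apply: lerD; last exact: b_min.
by case: ifP.
Qed.

(** If [c] is at its cap, [i0] leads to a mid class, and by [tau_mu] to an even, hence unraised,
    entry; otherwise a low class gives the support. *)
Lemma support_even q : top (q + j) -> ~~ odd (tau (q + j)) ->
  exists i, support q i.
Proof.
move=> /andP[nlow nmid]; rewrite tau_mu => ev.
have [E|[i [neq0 iW Ai]]] := c_att (cls (q + j)).
  exists i0; have iM : cls (q + i0) \in M.
    apply: top_cheap nlow nmid _; apply/existsP; exists i0.
    by rewrite off_i0 eqxx (cls_off q i0) eqxx.
  rewrite /support off_i0 /mid iM ev orbT E /lev iM.
  by have := mid_low iM; rewrite /low => -> /=.
exists i; rewrite /support neq0 /low /lev (cls_off q i) iW /= add0r; exact/eqP.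
Qed.

Definition term w q (i : 'I_n.+1) : R := zseq w (q + i) + A i.

Lemma support_term w q i : support q i -> term w q i = c (cls (q + j)).
Proof.
move=> /and3P[_ lm /eqP <-]; rewrite /term /zseq /raise.
by case: ifP lm => [_ _|_ /= /andP[-> /negPf ->]]; rewrite addr0.
Qed.

(** One pair serves all [w], so that the resulting sequences lie in a single polyhedron. *)
Definition min_pair q (i1 i2 : 'I_n.+1) : Prop := i1 != i2 /\
  forall w, (forall x, 0 <= w x <= eps) ->
  forall i, term w q i1 <= term w q i /\ term w q i2 <= term w q i.

Lemma min_pair_exists q : exists i1 i2, min_pair q i1 i2.
Proof.
have jNl : j != l by apply/eqP => /(congr1 (@nat_of_ord _)); lia.
have oj : off j = 0 by rewrite /off subrr.
have neqj i : off i != 0 -> i != j by apply: contraNneq => ->; apply/eqP.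
have neql i : off i != 0 -> i != l by apply: contraNneq => ->; rewrite off_l.
have w_ge0 (w : nat -> R) : (forall x, 0 <= w x <= eps) -> forall x, 0 <= w x.
  by move=> hw x; have /andP[] := hw x.
have term_ge w (i : 'I_n.+1) (hw : forall x, 0 <= w x <= eps) :
    lev (cls (q + i)) + A i <= term w q i.
  by rewrite /term /zseq addrAC lerDl raise_ge0 //; exact: w_ge0.
have lev_l : lev (cls (q + l)) = lev (cls (q + j)) by rewrite cls_l.
case jW : (low (q + j)).
  exists j, l; split=> // w hw i.
  have t0 : 0 <= term w q i.
    by apply: le_trans (term_ge _ _ hw); rewrite addr_ge0 ?lev_ge0.
  rewrite {1 3}/term /zseq /raise lev_l /low cls_l -/(low (q + j)) jW.
  by rewrite lev_cls jW !add0r Aj Al.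
case jM : (mid (q + j)).
  have := jM; rewrite /mid inE => /andP[_ /existsP[s /andP[sW /existsP[i]]]].
  move=> /and3P[neqi /eqP Ai /eqP Es].
  have lb w k (hw : forall x, 0 <= w x <= eps) : b <= term w q k.
    apply: le_trans (term_ge _ _ hw); have [eq0|neq0] := eqVneq (off k) 0.
      by rewrite (cls_off q k) eq0 addr0 lev_cls jW jM lerDl.
    by rewrite (le_trans (b_min neq0)) // lerDr lev_ge0.
  have Ti w : term w q i = b.
    by rewrite /term /zseq /raise /lev /low (cls_off q i) -Es sW !add0r.
  (* [mu] has opposite parities at [q + j] and [q + l], so one of these entries is unraised. *)
  case ev : (odd (mu (q + j))).
    exists i, l; split; first exact: neql.
    move=> w hw k; rewrite Ti lb // /term /zseq /raise /low /mid cls_l.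
    rewrite -/(low _) -/(mid _) jW jM Al qlE muDL oddD ev /= addr0 addr0.
    by rewrite lev_cls jW jM; split; rewrite ?lb.
  exists i, j; split; first exact: neqj.
  move=> w hw k; rewrite Ti lb // /term /zseq /raise jW jM Aj ev /= addr0 addr0.
  by rewrite lev_cls jW jM; split; rewrite ?lb.
have topj : top (q + j) by rewrite /top jW jM.
set r := cls (q + j); have lev_r : lev r = c r by rewrite lev_cls jW jM.
have lb w k (hw : forall x, 0 <= w x <= eps) : c r <= term w q k.
  by apply: le_trans (term_ge _ _ hw); exact: top_le.
have Tj w : term w q j = c r + raise w (q + j).
  by rewrite /term Aj addr0 /zseq lev_r.
have Tl w : term w q l = c r + raise w (q + l).
  by rewrite /term Al addr0 /zseq cls_l lev_r.
have Rj w : raise w (q + j) = if (tau (q + j) %% 4 == 1)%N then w (q + j)%N else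
    if [&& (tau (q + j) %% 4 == 2)%N, (L <= q + j)%N & ~~ lone (q + j - L)]
    then w (q + j - L)%N else 0.
  by rewrite /raise jW jM.
(* The residues are those of [q + j]; [tau] is one larger at [q + l]. *)
have Rl w : raise w (q + l) = if (tau (q + j) %% 4 == 0)%N then w (q + l)%N else
    if (tau (q + j) %% 4 == 1)%N && ~~ lone (q + j) then w (q + j)%N else 0.
  rewrite /raise /low /mid cls_l -/(low _) -/(mid _) jW jM qlE tauDL mul1n.
  rewrite leq_addl addnK /=.
  have [-> -> //] : ((tau (q + j) + 1) %% 4 == 1)%N = (tau (q + j) %% 4 == 0)%N /\
      ((tau (q + j) + 1) %% 4 == 2)%N = (tau (q + j) %% 4 == 1)%N.
  by move: (tau _) => t; clear; lia.
have supp_j i : support q i -> (forall w, raise w (q + j) = 0) -> min_pair q i j.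
  move=> si R0; split; first by case/and3P: si => /neqj.
  by move=> w hw k; rewrite (support_term _ si) Tj R0 addr0; split; apply: lb.
have supp_l i : support q i -> (forall w, raise w (q + l) = 0) -> min_pair q i l.
  move=> si R0; split; first by case/and3P: si => /neql.
  by move=> w hw k; rewrite (support_term _ si) Tl R0 addr0; split; apply: lb.
have [m3|m3] := eqVneq (tau (q + j) %% 4)%N 3%N.
  exists j, l; split=> // w hw k.
  by rewrite Tj Tl Rj Rl m3 /= addr0; split; apply: lb.
(* For residues 0 and 2, one entry of the class is unraised and parity provides a support to pair it
   with. *)
have [m0|m0] := eqVneq (tau (q + j) %% 4)%N 0%N.
  have [|i si] := support_even topj; first by move: m0; clear; lia.
  by exists i, j; apply: supp_j => // w; rewrite Rj m0.
have [m2|m2] := eqVneq (tau (q + j) %% 4)%N 2%N.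
  have [|i si] := support_even topj; first by move: m2; clear; lia.
  by exists i, l; apply: supp_l => // w; rewrite Rl m2.
have m1 : (tau (q + j) %% 4 = 1)%N by move: m0 m2 m3; clear; lia.
have loneE : lone (q + j) = [exists i, support q i].
  by rewrite /lone leq_addl m1 addnK negbK.
have [/existsP[i si]|nsupp] := boolP [exists i, support q i].
  exists i, l; apply: supp_l => // w; rewrite Rl m1 loneE /=.
  by case: ifP => // /existsP; case; exists i.
(* Both entries of the class are raised by [w (q + j)]; without a support, every other entry leaves
   room for this. *)
exists j, l; split=> // w hw k.
rewrite Tj Tl Rj Rl m1 loneE nsupp /=; suff : c r + w (q + j)%N <= term w q k by split.
have /andP[w0 we] := hw (q + j)%N.
have gap : c r < lev (cls (q + k)) + A k -> c r + w (q + j)%N <= term w q k.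
  move=> lt; apply: le_trans (term_ge _ _ hw).
  by have := @eps_gap r (cls (q + k)) k; rewrite lev_r; lra.
have [eq0|neq0] := eqVneq (off k) 0.
  have [->|->|Ak] := off_eq0 eq0.
  - by rewrite Tj Rj m1.
  - by rewrite Tl Rl m1 loneE nsupp.
  - by apply: gap; rewrite (cls_off q k) eq0 addr0 lev_r ltrDl.
have nsk : ~~ support q k by apply: contra nsupp => sk; apply/existsP; exists k.
have le_k := top_le k topj.
case kW : (low (q + k)).
  apply: gap; rewrite lt_neqAle le_k andbT.
  by move: nsk; rewrite /support neq0 kW /= eq_sym.
case kM : (mid (q + k)).
  (* Level and [A k] may add up to exactly [c r] here, but the entry is raised by at least [eps]. *)
  case od : (odd (mu (q + k))).
    rewrite /term /zseq /raise kW kM od.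
    by have := w_ge0 _ hw (q + k)%N; move: le_k we; rewrite -/r; lra.
  apply: gap; rewrite lt_neqAle le_k andbT.
  by move: nsk; rewrite /support neq0 kM od orbT /= eq_sym.
apply: gap; apply: (le_lt_trans (c_le2b _)).
rewrite lev_cls kW kM; apply: ler_ltD => //.
(* Equality would be a cheap step from a top class, which ends in a mid class. *)
rewrite lt_neqAle b_min // andbT; apply: contraFneq kM => bA.
apply: (top_cheap (negbT jW) (negbT jM)); apply/existsP; exists k.
by rewrite neq0 -bA eqxx (cls_off q k) eqxx.
Qed.

Lemma raise_rep w x : rep x -> raise w x - raise (fun=> 0) x = w x.
Proof.
rewrite /rep /raise /top => /orP[/andP[mx ->]|/andP[/andP[/negPf -> /negPf ->] ->]].
  by rewrite mid_low // mx addr0 addrC addKr.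
by rewrite subr0.
Qed.

(** Along four steps of [L], [mu] is odd twice and [tau] takes each residue modulo 4 once. *)
Lemma rep_period x :
  (rep x + rep (x + 1 * L) + rep (x + 2 * L) + rep (x + 3 * L) = mid x + mid x + top x)%N.
Proof.
rewrite /rep /top /low /mid !clsDL -/(low x) -/(mid x) !muDL !tauDL !(oddD (mu x)).
case mx : (mid x); first by rewrite mid_low //; case: (odd (mu x)).
by case: (low x) => //=; lia.
Qed.

Lemma sum_cls (F : 'Z_L -> nat) : \sum_(0 <= t < L) F (cls t) = \sum_r F r.
Proof.
have cast (G : nat -> nat) :
    \sum_(0 <= t < L) G t = \sum_(0 <= t < (Zp_trunc L).+2) G t by rewrite Zp_cast.
by rewrite cast big_mkord; apply: eq_bigr => r _; rewrite /cls natr_Zp.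
Qed.

(* A period of length 4 L has 2 |M| + (L - |W| - |M|) representatives. *)
Lemma sum_rep q : (q * L <= \sum_(0 <= x < q * 4 * L) rep x)%N.
Proof.
pose g i := (\sum_(0 <= t < L) rep (t + i * L))%N.
have -> : (\sum_(0 <= x < q * 4 * L) rep x = \sum_(0 <= i < q * 4) g i)%N.
  rewrite big_nat_mul; apply: eq_bigr => i _.
  by rewrite -[X in index_iota X _]add0n big_addn mulSn addnK.
rewrite big_nat_mul; have -> : (q * L = \sum_(0 <= i < q) L)%N.
  by rewrite sum_nat_const_nat subn0.
apply: leq_sum => y _.
have -> : (\sum_(y * 4 <= i < y.+1 * 4) g i =
    \sum_(0 <= t < L) ((cls t \in M) + (cls t \in M) + (cls t \notin W :|: M)%SET))%N.
  rewrite -[X in index_iota X _]add0n big_addn mulSn addnK.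
  rewrite !big_nat_recr //= big_geq // add0n -!big_split /=.
  apply: eq_bigr => t _.
  have -> : cls t = cls (t + y * 4 * L) by rewrite clsDL.
  rewrite finset.in_setU negb_or -rep_period -!addnA -!mulnDl.
  by rewrite ?add0n ![(y * 4 + _)%N]addnC.
rewrite (sum_cls (fun r => (r \in M) + (r \in M) + (r \notin W :|: M)%SET)%N).
rewrite !big_split /= -!big_mkcond /=.
have -> : (\sum_(r | r \notin (W :|: M)%SET) 1 = #|~: (W :|: M)%SET|)%N.
  by rewrite -sum1_card; apply: eq_bigl => r; rewrite finset.in_setC.
have : (#|W :|: M| + #|~: (W :|: M)| = L)%N by rewrite cardsC card_ord Zp_cast.
(* [W :|: M] has at most [2 |M|] elements, so counting mid classes twice makes up for the low
   ones. *)
have [+ _] := leq_card_setU W M; move: W_le_M; rewrite !sum1_card.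
by move: #|W| #|M| #|_ :|: _| #|~: _| => w m u v; clear; lia.
Qed.

Lemma family_of_levels : solution_family L A.
Proof.
pose w (y x : nat) : R := if x == y then eps else 0.
have w_eps y x : 0 <= w y x <= eps by rewrite /w; case: ifP; rewrite ?lexx ltW.
have /choice[f fP] q : exists i : 'I_n.+1 * 'I_n.+1, min_pair q i.1 i.2.
  by have [i1 [i2 H]] := min_pair_exists q; exists (i1, i2).
pose s q (k : bool) := if k then (f q).1 else (f q).2.
exists eps, (zseq (fun=> 0)), (fun y x => zseq (w y) x - zseq (fun=> 0) x), s, rep.
have minz v : (forall x, 0 <= v x <= eps) -> forall q k (i : 'I_n.+1),
    zseq v (q + s q k) + A (s q k) <= zseq v (q + i) + A i.
  by move=> hv q k i; have [_ /(_ v hv i)[]] := fP q; rewrite /s; case: k.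
split=> [|q|q k i|y q k i|].
- by rewrite gt_eqF.
- by have [] := fP q.
- by apply: minz => x; rewrite lexx ltW.
- by rewrite !subrKC; exact: minz.
- split=> [x y xrep|]; last exact: sum_rep.
  by rewrite /zseq opprD addrACA subrr add0r raise_rep.
Qed.

End Levels.

Lemma wide_edge_family : solution_family L A.
Proof.
have jn : (j.+1 < n.+1)%N by have := ltn_ord l; lia.
(* As [L > 1], the index [j + 1] leads to another class, so the minimum defining [b] exists. *)
have off1 : off (inord j.+1) != 0.
  by rewrite /off inordK // /cls -natrB ?leqnSn // subSnn oner_neq0.
case: (@arg_minP _ _ _ _ (fun i => off i != 0) A off1) => i0 off_i0 b_min.
have irr : irreflexive (cheap i0).
  move=> r; apply/existsP => -[i /and3P[neq0 _]].
  by rewrite -[X in X == _]addr0 (inj_eq (addrI r)) eq_sym (negPf neq0).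
have [W W_le_M top_cheap] := low_mid_top irr.
have b_ge0 := A_ge0 i0.
have /choice[c cP] (r : 'Z_L) : exists c, [/\ A i0 <= c, c <= A i0 + A i0,
    forall i, off i != 0 -> r + off i \in W -> c <= A i &
    c = A i0 + A i0 \/ exists i, [/\ off i != 0, r + off i \in W & A i = c]].
  pose P i := (off i != 0) && (r + off i \in W).
  have [i Pi|noP] := pickP P; last first.
    exists (A i0 + A i0); split; rewrite ?lerDl //; last by left.
    by move=> i neq0 iW; move: (noP i); rewrite /P neq0 iW.
  case: (@arg_minP _ _ _ _ P A Pi) => k /andP[k0 kW] min_k.
  case: (leP (A k) (A i0 + A i0)) => Ak.
    exists (A k); split=> //; first exact: b_min.
      by move=> i' i0' iW; apply: min_k; rewrite /P i0' iW.
    by right; exists k.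
  exists (A i0 + A i0); split; rewrite ?lerDl //; last by left.
  by move=> i' i0' iW; apply: (le_trans (ltW Ak)); apply: min_k; rewrite /P i0' iW.
(* The levels depend only on classes, so finitely many differences occur and one margin serves all
   windows. *)
have [eps eps_gt0 gap] := gap_exists (fun x : 'Z_L * 'Z_L * 'I_n.+1 =>
  lev i0 W c x.1.2 + A x.2 - lev i0 W c x.1.1).
apply: (@family_of_levels i0 off_i0 b_min W W_le_M top_cheap c _ _ _ _ eps) => //.
- by move=> r; have [] := cP r.
- by move=> r; have [] := cP r.
- by move=> r i; have [_ _ + _] := cP r; apply.
- by move=> r; have [] := cP r.
- by move=> r r' i; exact: (gap (r, r', i)).
Qed.

End Construction.

(** * From free entries to the entropy bound *)

Lemma tdim_ge_family (R : realType) n (a : 'I_n.+1 -> int) (s : R) j L q :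
  solution_family L (height_above a s j) -> (q * L <= tdim R a (q * 4 * L))%N.
Proof.
move=> [e [p [d [sel [rp [e0 sel_neq minp mind [d_rp count_rp]]]]]]].
apply: leq_trans (count_rp q) _; set k := (q * 4 * L)%N.
pose X := [set x : 'I_k | rp x]%SET.
have -> : (\sum_(0 <= x < k) rp x = #|X|)%N.
  rewrite big_mkord -sum1_card [RHS]big_mkcond /=; apply: eq_bigr => x _.
  by rewrite inE; case: (rp x).
(* The linear term turns [height_above] back into [a], up to a constant on each window. *)
pose pv : 'rV[R]_k := \row_x (p x - s * x%:R).
pose V : 'M[R]_(#|X|, k) := \matrix_(y < #|X|, x < k) d (enum_val y : 'I_k) x.
apply: (@tdim_ge _ _ _ _ _ pv V (fun w => sel w)) => [w||_ [->|[y ->]] w c i].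
- exact: sel_neq.
(* On the columns in [X], the matrix [V] is [e] times the identity. *)
- apply/row_freeP; exists (\matrix_(x, y) (if x == enum_val y then e^-1 else 0)).
  apply/matrixP => y y'; rewrite mxE (bigD1 (enum_val y')) //= big1 => [|x neq].
    have rp_y' : rp (enum_val y') by have := enum_valP y'; rewrite inE.
    rewrite !mxE eqxx addr0 d_rp // (inj_eq val_inj) (inj_eq enum_val_inj) eq_sym.
    by case: eqP; rewrite ?mul0r ?mulfV.
  by rewrite !mxE (negPf neq) mulr0.
- have := minp w c i; rewrite /height_above !mxE /= !natrD; lra.
- have := mind (enum_val y : 'I_k) w c i; rewrite /height_above !mxE /= !natrD; lra.
Qed.

(** With d for [tdim R a], the family gives [k L <= d(4 L k)], and subadditivity gives
    [d(4 L k) <= 4 L d(k)]; so the bound holds for each single [k]. *)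
Lemma quarter_le_tdim (R : realType) n (a : 'I_n.+1 -> int) k :
  ~ regular R a -> (0 < k)%N -> 4^-1 <= (tdim R a k)%:R / k%:R :> R.
Proof.
move=> /nonregular_wide_edge[s [j [l [jl l0 ge0 gt0]]]] k0.
have j0 : height_above a s j j = 0 by rewrite /height_above !subrr mul0r subrr.
pose L := (l - j)%N.
have L_gt1 : (1 < L)%N by rewrite /L; lia.
have lE : l = (L + j)%N :> nat by rewrite /L; lia.
have := tdim_ge_family k (wide_edge_family L_gt1 lE j0 l0 ge0 gt0).
rewrite -mulnA [(k * (4 * L))%N]mulnC => /leq_trans/(_ (tdimM _ _ _ _)).
rewrite (mulnAC 4) leq_pmul2r ?(ltnW L_gt1) // => le_k.
by rewrite ler_pdivlMr ?ltr0n // ler_pdivrMl // -natrM ler_nat.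
Qed.

Theorem theorem7p1 (R : realType) (n : nat) (a : 'I_n.+1 -> int) :
  (1 <= n)%N -> ~ regular R a -> 4^-1 <= trop_entropy R a.
Proof.
move=> _ nreg; rewrite /trop_entropy (cvg_lim _ (@fekete R _ (@tdimD R n a))) //.
apply: lb_le_inf; first by exists ((tdim R a 1)%:R / 1%:R), 1%N.
by move=> _ [k k0 <-]; exact: quarter_le_tdim.
Qed.
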